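(* If $G$ is a graph with independence number $m\geq 2$ and $$|V(G)|\leq \frac{m^2-m+2}{m^2-3m+4}\,\chi(G),$$ then $\chi(G)=\chi_p(G)$.
   Context: All graphs are finite and simple. $\chi(G)$ is the chromatic number; the independence number is the maximum size of an independent set. On-line $f$-list coloring game. Given a graph $G$ and an integer-valued function $f$ on $V(G)$, two players Alice and Bob play as follows. Initially all vertices are uncolored. In round $i$, Alice marks a nonempty subset $V_i$ of the remaining uncolored vertices (assigning color $i$ as a permissible color to each vertex of $V_i$); then Bob chooses an independent set $X_i\subseteq V_i$ and colors all vertices of $X_i$ with color $i$. If at the end of some round there is a vertex $v$ that has been marked $f(v)$ times but is not yet colored, Alice wins. Otherwise Bob wins, i.e. in the end each vertex $v$ is colored by Bob before running out of $f(v)$ permissible colors. $G$ is on-line $f$-choosable if Bob has a winning strategy, and on-line $k$-choosable if this holds for the constant function $f\equiv k$. The on-line choice number $\chi_p(G)$ (the subscript $p$ is just notation) is the minimum $k$ such that $G$ is on-line $k$-choosable. *)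

(* Defs.v *)
From HB Require Import structures.
From mathcomp Require Import all_boot all_order all_algebra.
From mathcomp Require Import boolp.

Set Implicit Arguments.
Unset Strict Implicit.
Unset Printing Implicit Defensive.

Import Order.TTheory GRing.Theory Num.Theory.

Record sgraph := SGraph {
  vertex :> finType;
  adj : rel vertex;
  adj_sym : symmetric adj;
  adj_irr : irreflexive adj }.

Definition independent (G : sgraph) (A : {set G}) : bool :=
  [forall x in A, forall y in A, ~~ adj x y].

Definition independence_number (G : sgraph) : nat :=
  \max_(A : {set G} | independent A) #|A|.

Definition colorable (G : sgraph) (k : nat) : bool :=
  [exists c : {ffun G -> 'I_k}, forall x, forall y, adj x y ==> (c x != c y)].

Lemma colorable_card (G : sgraph) : colorable G #|G|.
Proof.
apply/existsP; exists [ffun x => enum_rank x].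
apply/forallP => x; apply/forallP => y; apply/implyP => xy.
rewrite !ffunE (inj_eq enum_rank_inj).
by apply/eqP => exy; rewrite exy adj_irr in xy.
Qed.

Definition chromatic_number (G : sgraph) : nat :=
  ex_minn (ex_intro (fun k => is_true (colorable G k)) #|G| (colorable_card G)).

(* A history is the list of the sets marked by Alice so far, the most recent
   first. A strategy of Bob maps a history, including the set just marked, to
   the set he colors; his own earlier moves are determined by the strategy. *)
Definition strategy (G : sgraph) := seq {set G} -> {set G}.

Fixpoint uncolored (G : sgraph) (s : strategy G) (h : seq {set G}) : {set G} :=
  if h is _ :: h' then uncolored s h' :\: s h else [set: G].

Fixpoint legal (G : sgraph) (s : strategy G) (h : seq {set G}) : bool :=
  if h is V :: h' then
    [&& legal s h', V != set0 & V \subset uncolored s h']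
  else true.

Definition marks (G : sgraph) (h : seq {set G}) (v : G) : nat :=
  count (fun V : {set G} => v \in V) h.

(* The second condition includes the empty history, so Bob has lost at once if
   some f v <= 0: such a vertex has no permissible color to be colored with.
   A play has no infinite continuation under this condition, since the number
   of marks of a vertex never exceeds f; hence in the end all vertices are
   colored. *)
Definition winning (G : sgraph) (f : G -> int) (s : strategy G) : Prop :=
  (forall (V : {set G}) (h : seq {set G}), legal s (V :: h) ->
     s (V :: h) \subset V /\ independent (s (V :: h))) /\
  (forall (h : seq {set G}) (v : G), legal s h -> v \in uncolored s h ->
     ((marks h v)%:Z < f v)%R).

Definition online_f_choosable (G : sgraph) (f : G -> int) : Prop :=
  exists s : strategy G, winning f s.

Definition online_choosable (G : sgraph) (k : nat) : Prop :=
  online_f_choosable (fun _ : G => k%:Z%R).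

Lemma online_choosable_card (G : sgraph) : online_choosable G #|G|.
Proof.
pose s : strategy G := fun h =>
  if h is V :: _ then if [pick v in V] is Some v then [set v] else set0
  else set0.
exists s; split.
  move=> V h _ /=; case: pickP => [v vV|_].
    rewrite sub1set vV; split=> //.
    apply/forall_inP => x /set1P ->; apply/forall_inP => y /set1P ->.
    by rewrite adj_irr.
  by rewrite sub0set; split=> //; apply/forall_inP => x; rewrite inE.
have card_unc h : legal s h -> #|uncolored s h| + size h <= #|G|.
  elim: h => [|V h IH]; first by rewrite /= cardsT addn0.
  case/and3P => lh V0 VU; apply: leq_trans (IH lh).
  rewrite [uncolored _ _]/= [size _]/= addnS -addSn leq_add2r.
  case: pickP => [v vV|V_0]; last first.
    by case/set0Pn: V0 => v; rewrite V_0.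
  by rewrite [X in _ <= X](cardsD1 v) (subsetP VU).
move=> h v lh vU; rewrite ltz_nat.
apply: leq_ltn_trans (count_size _ _) _.
apply: leq_trans (card_unc h lh).
by rewrite -[X in X <= _]add1n leq_add2r card_gt0; apply/set0Pn; exists v.
Qed.

Lemma online_choice_number_ex (G : sgraph) :
  exists k, `[< online_choosable G k >].
Proof. by exists #|G|; apply/asboolP; apply: online_choosable_card. Qed.

Definition online_choice_number (G : sgraph) : nat :=
  ex_minn (online_choice_number_ex G).

(* Main.v *)
(* Colour G optimally with k = chromatic_number G classes and let Bob only ever
   colour the marked vertices of one class at a time. Bob keeps two kinds of
   classes: a queue of urgent blocks, each with a level, and a list of parts of
   size at least 2. Inside a part he only controls sums of tokens: every j-subset
   has at least [demand j] tokens. Inside a block every single vertex has enough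
   tokens to wait for its turn. When Alice marks a set M, Bob colours the marked
   vertices of the first available of the following:
   1. a part contained in M;
   2. a part having a marked subset U whose token sum is exactly its demand,
      with |U| maximal: each unmarked vertex v of the part is then rich, because
      U with v added satisfies its own demand, so that the rest of the part
      becomes a block of level |U|;
   3. the first marked block of the queue, provided that its level is at least
      the maximal number w of marked vertices in a part;
   4. a part with w marked vertices; if a single vertex is left, it becomes the
      first block of the queue.
   Initially the singleton classes are blocks, and the demands are met as soon as
   the number of singletons is at least the sum of binomial(p - 1, 2) over the
   sizes p of the other classes, which the bound on |G| guarantees. *)

Require Import Defs.
From mathcomp Require Import all_boot all_order all_algebra.
From mathcomp Require Import boolp zify ring lra.

Set Implicit Arguments.
Unset Strict Implicit.
Unset Printing Implicit Defensive.

(** * Token costs and waiting times of a single part *)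

(** The share of the demand on a [j]-subset that is due to a part of [q] vertices; for [0 < j] it is
    j + (q-2) + ... + (q-j), each difference truncated at 0. *)
Definition part_cost (j q : nat) : nat := j + \sum_(i < j.-1) (q - i.+2).
(* The increment of [part_cost] from j = l to j = l + 1, which is what makes the
   remainder of a part safe in move 2. *)
Definition part_delay (l q : nat) : nat := (q - l.+1).+1.

Lemma part_costS (t q : nat) :
  0 < t -> part_cost t.+1 q = part_cost t q + part_delay t q.
Proof. by case: t => // t _; rewrite /part_cost /part_delay big_ord_recr /=; lia. Qed.

Lemma part_cost_ge_full (j p : nat) : j <= part_cost j p.
Proof. exact: leq_addr. Qed.

(** Each summand [p - i.+2] has [i.+2 <= j <= w]. *)
Lemma part_cost_ge_small (j w p : nat) :
  j <= w -> j + j.-1 * (p - w) <= part_cost j p.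
Proof.
move=> jw; rewrite leq_add2l.
have -> : j.-1 * (p - w) = \sum_(i < j.-1) (p - w) by rewrite sum_nat_const card_ord.
by apply: leq_sum => -[i /= ij] _; lia.
Qed.

(** The left product exceeds the sum by t(3 - t)/2, which is 1 for t = 1, 2 and at most 0 otherwise;
    hence the successor. *)
Lemma sum_sub_ge_mul (t p : nat) : t < p -> t * (p - t) <= (\sum_(i < t) (p - i.+2)).+1.
Proof.
elim: t => [|t IH] tp; first by rewrite mul0n.
rewrite big_ord_recr /=; case: t IH tp => [|t] IH tp; first by rewrite big_ord0; lia.
move: (IH (ltnW tp)); rewrite -(subnK tp); set d := p - _; set S := \sum_(i < _) _.
have -> : d + t.+3 - t.+1 = d.+2 by lia.
have -> : d + t.+3 - t.+2 = d.+1 by lia.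
by nia.
Qed.

Lemma sum_sub_mono (n n' p : nat) :
  n <= n' -> \sum_(i < n) (p - i.+2) <= \sum_(i < n') (p - i.+2).
Proof.
elim: n' => [|n' IH]; first by rewrite leqn0 => /eqP ->.
rewrite leq_eqVlt => /predU1P[-> //|nn'].
by rewrite big_ord_recr /=; apply: leq_trans (IH nn') (leq_addr _ _).
Qed.

Lemma part_cost_ge_large (j t w p : nat) :
  t <= w -> w < p -> t < j -> j.-1 + t * (p - w) <= part_cost j p.
Proof.
move=> tw wp tj; have tj' : t <= j.-1 by lia.
have := sum_sub_ge_mul (leq_ltn_trans tw wp); have := sum_sub_mono p tj'.
have : t * (p - w) <= t * (p - t) by rewrite leq_mul2l; lia.
by rewrite /part_cost; lia.
Qed.

(** For [1 < j] already the summand with [i = 0] drops by [w], because [w <= q - 2]. *)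
Lemma part_cost_drop (j w q : nat) :
  w.+2 <= q -> part_cost j (q - w) + minn j.-1 w <= part_cost j q.
Proof.
move=> wq; rewrite /part_cost -addnA leq_add2l.
elim: j.-1 => [|n IH]; first by rewrite !big_ord0; lia.
rewrite !big_ord_recr /=; move: IH.
by set a := \sum_(_ < n) _; set b := \sum_(_ < n) _; move: a b => a b; clear -wq; lia.
Qed.

Lemma part_cost_ge_last (j q : nat) :
  0 < j -> j.-1 + minn j.-1 q <= part_cost j q.+1.
Proof.
move=> j0; rewrite /part_cost.
suff: minn j.-1 q.-1 <= \sum_(i < j.-1) (q.+1 - i.+2) by lia.
elim: j.-1 => [|n IH]; first by rewrite min0n.
rewrite big_ord_recr /=; move: IH.
by set a := \sum_(_ < n) _; move: a => a; clear; lia.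
Qed.

Lemma part_cost_le (j q : nat) : part_cost j q <= j + 'C(q.-1, 2).
Proof.
rewrite leq_add2l; elim: q j.-1 => [|q IH] n; first by rewrite big1.
case: n => [|n]; first by rewrite big_ord0.
rewrite big_ord_recl /=; case: q IH => [|q] IH; first by rewrite big1.
by rewrite binS bin1 addnC subn2 leq_add // (leq_trans _ (IH n)).
Qed.

Lemma part_delay_drop (l w q : nat) :
  w.+2 <= q -> part_delay l (q - w) + (l < w) <= part_delay l q.
Proof. by rewrite /part_delay; lia. Qed.

Lemma part_delay_last (l w : nat) : 1 + (l < w) <= part_delay l w.+1.
Proof. by rewrite /part_delay; lia. Qed.

(** * Positions of the game and the invariant *)

Section Positions.
Context {G : sgraph}.
Implicit Types (f : G -> nat) (M A U Q : {set G}) (R : seq {set G}) (s : seq (nat * {set G})).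
(** Waiting time that the parts may still cause to a block of level [l]. It decreases with [l],
    since move 4 passes over a marked block only if some part has more than [l] marked vertices. *)
Definition delay (l : nat) R : nat := \sum_(Q <- R) part_delay l #|Q|.

(** The factor of a block reflects move 3: at most [x.1] vertices of a part are then marked, and a
    [j]-subset marked entirely has a token to spare, as it is not tight. *)
Definition demand (j : nat) s R : nat :=
  \sum_(x <- s) minn j.-1 x.1 * #|x.2| + \sum_(Q <- R) part_cost j #|Q|.

(* [a] counts the vertices of the blocks in front of the queue [s]. *)
Fixpoint queue_ok f R (a : nat) s : bool :=
  if s is x :: s' then
    [forall v in x.2, a + delay x.1 R < f v] && queue_ok f R (a + #|x.2|) s'
  else true.

Lemma queue_ok_cat f R a s1 s2 :
  queue_ok f R a (s1 ++ s2) =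
  queue_ok f R a s1 && queue_ok f R (a + \sum_(x <- s1) #|x.2|) s2.
Proof.
elim: s1 a => [|x s1 IH] a /=; first by rewrite big_nil addn0.
by rewrite IH big_cons addnA andbA.
Qed.

Definition spend f M : G -> nat := fun v => f v - (v \in M).

(** A block with a marked vertex may lose one token per vertex, so its waiting time has to shrink by
    at least one. *)
Lemma queue_ok_spend f M R R' a a' s :
  (forall x, x \in s -> a' + delay x.1 R' + (x.2 :&: M != set0) <= a + delay x.1 R) ->
  queue_ok f R a s -> queue_ok (spend f M) R' a' s.
Proof.
elim: s a a' => //= x s IH a a' le_s /andP[/forall_inP fx ok_s]; apply/andP; split.
  apply/forall_inP => v vx; have := fx v vx; have := le_s x (mem_head _ _); rewrite /spend.
  case: (boolP (v \in M)) => [vM|_]; last by lia.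
  have -> : x.2 :&: M != set0 by apply/set0Pn; exists v; rewrite inE vx.
  by rewrite /=; lia.
apply: IH ok_s => y ys; have := le_s y; rewrite inE ys orbT => /(_ isT).
by lia.
Qed.

Lemma sum_spend f M U : \sum_(v in U) f v <= \sum_(v in U) spend f M v + #|U :&: M|.
Proof.
have -> : #|U :&: M| = \sum_(v in U) (v \in M).
  by rewrite -sum1_card big_mkcond [RHS]big_mkcond; apply: eq_bigr => v _; rewrite inE; case: (v \in U).
by rewrite -big_split; apply: leq_sum => v _; rewrite /spend /=; lia.
Qed.

(* In a queue the first component of a pair is the level of the block. The blocks
   and parts need not be disjoint, and they may contain colored vertices: the
   conditions are lower bounds on tokens, which colored vertices can only make
   stronger. *)
Record good (T : nat) A f s R : Prop := Good {
  good_cover : forall v, v \in A ->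
    has (fun x : nat * {set G} => v \in x.2) s || has (fun Q : {set G} => v \in Q) R;
  good_block : forall x, x \in s -> independent x.2 /\ x.1 <= T;
  good_sorted : pairwise (fun x y => y.1 <= x.1) s;
  good_part : forall Q, Q \in R -> [/\ independent Q, 1 < #|Q| & #|Q| <= T.+1];
  good_queue : queue_ok f R 0 s;
  good_sum : forall Q U, Q \in R -> U \subset Q ->
    demand #|U| s R <= \sum_(v in U) f v }.

Lemma independentS A U : U \subset A -> independent A -> independent U.
Proof.
move=> /subsetP UA /forall_inP iA; apply/forall_inP => x xU; apply/forall_inP => y yU.
by have /forall_inP := iA _ (UA _ xU); apply; apply: UA.
Qed.

Lemma has_rem R Q v : v \notin Q ->
  has (fun P : {set G} => v \in P) R -> has (fun P : {set G} => v \in P) (rem Q R).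
Proof.
move=> vQ; case: (boolP (Q \in R)) => [QR|QR]; last by rewrite rem_id.
by rewrite (eq_has_r (perm_mem (perm_to_rem QR))) /= (negPf vQ).
Qed.

Lemma delay_rem l R Q : Q \in R -> delay l R = part_delay l #|Q| + delay l (rem Q R).
Proof. by move=> QR; rewrite /delay (big_rem _ QR). Qed.

Lemma delay_cons l R Q : delay l (Q :: R) = part_delay l #|Q| + delay l R.
Proof. by rewrite /delay big_cons. Qed.

Lemma delay_top T R : (forall Q, Q \in R -> #|Q| <= T.+1) -> delay T R = size R.
Proof.
move=> leR; rewrite -sum1_size /delay; apply: eq_big_seq => Q /leR.
by rewrite /part_delay; lia.
Qed.

Lemma demand0 s R : demand 0 s R = 0.
Proof.
rewrite /demand !big1 // => [Q _|x _]; first by rewrite /part_cost big_ord0.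
by rewrite min0n.
Qed.

Lemma demand1 s R : demand 1 s R = size R.
Proof.
rewrite -sum1_size /demand [X in X + _]big1 => [|x _]; last by rewrite min0n.
by apply: eq_bigr => Q _; rewrite /part_cost big_ord0.
Qed.

Lemma demand_rem j s R Q :
  Q \in R -> demand j s R = part_cost j #|Q| + demand j s (rem Q R).
Proof. by move=> QR; rewrite /demand (big_rem _ QR) /= addnCA. Qed.

Lemma demand_cons j x s R :
  demand j (x :: s) R = minn j.-1 x.1 * #|x.2| + demand j s R.
Proof. by rewrite /demand big_cons addnA. Qed.

Lemma demand_cat j s1 s2 R : demand j (s1 ++ s2) R = demand j s1 [::] + demand j s2 R.
Proof. by rewrite /demand big_cat big_nil /= addn0 addnA. Qed.

Lemma le_sum_spend f M U (d : nat) :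
  d + #|U :&: M| <= \sum_(v in U) f v -> d <= \sum_(v in U) spend f M v.
Proof. by have := sum_spend f M U; lia. Qed.

(** * Bob's four moves preserve the invariant *)

Lemma good_full T A f s R M Q : good T A f s R -> Q \in R -> Q \subset M ->
  good T (A :\: Q) (spend f M) s (rem Q R).
Proof.
move=> g QR QM; have [iQ Q2 QT] := good_part g QR; split.
- move=> v /setDP[vA vQ]; have /orP[->//|vR] := good_cover g vA.
  by rewrite (has_rem vQ vR) orbT.
- exact: (good_block g).
- exact: (good_sorted g).
- by move=> P /mem_rem PR; apply: (good_part g).
- apply: queue_ok_spend (good_queue g) => x xs.
  by rewrite (delay_rem _ QR) /part_delay; case: (_ != _) => /=; lia.
move=> P U /mem_rem PR UP; apply: le_sum_spend.
(* The removed part contributed at least [#|U|] to the demand, which covers all tokens spent on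
   [U]. *)
apply: leq_trans (good_sum g PR UP); rewrite (demand_rem _ _ QR) addnC leq_add2r.
by rewrite (leq_trans _ (part_cost_ge_full _ _)) ?subset_leq_card ?subsetIl.
Qed.

Lemma pairwise_level_split s t : pairwise (fun x y => y.1 <= x.1) s ->
  s = [seq x <- s | t <= x.1] ++ [seq x <- s | x.1 < t].
Proof.
elim: s => //= x s IH /andP[/allP xs ps]; case: leqP => [tx|xt] /=.
  by rewrite -IH.
have -> : [seq y <- s | t <= y.1] = [::].
  rewrite -(filter_pred0 s); apply: eq_in_filter => y /xs /= yx.
  by apply/negbTE; rewrite -ltnNge (leq_ltn_trans yx).
congr (_ :: _); apply/esym/all_filterP/allP => y /xs /= yx.
exact: leq_ltn_trans yx xt.
Qed.

Lemma cardsDI M Q : #|Q :\: M| = #|Q| - #|M :&: Q|.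
Proof. by rewrite cardsD setIC. Qed.

(** The increment counts the vertices in front of a new block of level [t] and adds its delay:
    exactly the wait that a vertex of this block must afford in move 2. *)
Lemma demandS t s R : 0 < t ->
  demand t.+1 s R = demand t s R + \sum_(x <- s | t <= x.1) #|x.2| + delay t R.
Proof.
move=> t0; rewrite /demand /delay.
under [X in _ + X = _]eq_bigr do rewrite part_costS //.
rewrite big_split [X in _ = _ + X + _]big_mkcond /= addnA; congr (_ + _).
rewrite addnAC -big_split /=; congr (_ + _); apply: eq_bigr => x _.
rewrite /=; have -> : minn t x.1 = minn t.-1 x.1 + (t <= x.1) by lia.
by rewrite mulnDl; case: leqP; rewrite ?mul1n.
Qed.

Lemma demand_level_block t B s R j :
  demand j ([seq x <- s | t <= x.1] ++ (t, B) :: [seq x <- s | x.1 < t]) R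
   = minn j.-1 t * #|B| + demand j ([seq x <- s | t <= x.1] ++ [seq x <- s | x.1 < t]) R.
Proof. by rewrite !demand_cat demand_cons /=; lia. Qed.

Lemma good_tight T A f s R M Q U :
  good T A f s R -> Q \in R -> (forall P, P \in R -> ~~ (P \subset M)) ->
  U \subset Q -> U \subset M -> 0 < #|U| -> \sum_(v in U) f v <= demand #|U| s R ->
  (forall P U', P \in R -> U' \subset P -> U' \subset M -> #|U| < #|U'| ->
     demand #|U'| s R < \sum_(v in U') f v) ->
  good T (A :\: (M :&: Q)) (spend f M)
    ([seq x <- s | #|U| <= x.1] ++ (#|U|, Q :\: M) :: [seq x <- s | x.1 < #|U|])
    (rem Q R).
Proof.
move=> g QR nofull UQ UM; set t := #|U| => t0 tight maxt.
have [iQ Q2 QT] := good_part g QR.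
have Ds := pairwise_level_split t (good_sorted g).
have UMQ : t <= #|M :&: Q| by rewrite subset_leq_card // subsetI UM.
have MQQ : #|M :&: Q| < #|Q|.
  rewrite proper_card // properE subsetIr /=.
  by apply: contra (nofull _ QR) => /subset_trans; apply; apply: subsetIl.
have cQM : #|Q :\: M| = #|Q| - #|M :&: Q| by apply: cardsDI.
split.
- move=> v /setDP[vA vMQ]; have := good_cover g vA; rewrite {1}Ds !has_cat /= inE.
  case: (has _ _) => //=; case: (has _ _) => /=; rewrite ?orbT ?orbF //= => vR.
  move: vMQ; rewrite inE; case: (boolP (v \in Q)) => vQ; first by rewrite !andbT => ->.
  by rewrite (has_rem vQ vR) orbT.
- move=> x; rewrite mem_cat inE => /or3P[|/eqP->|].
  + by rewrite mem_filter => /andP[_]; apply: (good_block g).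
  + split; last by rewrite /=; lia.
    by apply: independentS iQ; apply: subsetDl.
  + by rewrite mem_filter => /andP[_]; apply: (good_block g).
- have := good_sorted g; rewrite {1}Ds !pairwise_cat => /and3P[al -> ps2].
  rewrite /= ps2 andbT /=; apply/andP; split; last first.
    by apply/allP => x; rewrite mem_filter => /andP[/ltnW].
  rewrite allrel_consr al andbT; apply/allP => x.
  by rewrite mem_filter => /andP[].
- by move=> P /mem_rem PR; apply: (good_part g).
- have := good_queue g; rewrite {1}Ds !queue_ok_cat add0n => /andP[q1 q2].
  rewrite /=; apply/and3P; split.
  + apply: queue_ok_spend q1 => x _.
    by rewrite (delay_rem _ QR) /part_delay; case: (_ != _) => /=; lia.
  + apply/forall_inP => v /setDP[vQ vM].
    have vU : v \notin U by apply: contra vM; apply/subsetP.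
    have UvQ : v |: U \subset Q by rewrite subUset sub1set vQ.
    (* [U] holds at most [demand t] tokens and [v |: U] at least [demand t.+1], so [v] holds the
       increment. Removing [Q] from the delay makes the inequality strict. *)
    have := good_sum g QR UvQ; rewrite cardsU1 vU big_setU1 //= add1n demandS //.
    rewrite big_filter (delay_rem t QR) /part_delay /spend (negPf vM) subn0 -/t.
    by lia.
  (* Blocks behind the new one have a level below [t <= #|M :&: Q|], so the delay due to [Q]
     exceeded the number of vertices of [Q :\: M] now in front of them. *)
  apply: queue_ok_spend q2 => x; rewrite mem_filter => /andP[xt _].
  rewrite cQM (delay_rem _ QR) /part_delay.
  by case: (_ != _) => /=; lia.
move=> P U' /mem_rem PR U'P; apply: le_sum_spend.
rewrite demand_level_block -Ds cQM.
have := good_sum g PR U'P; rewrite (demand_rem _ _ QR).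
have cU' : #|U' :&: M| <= #|U'| by rewrite subset_leq_card ?subsetIl.
(* The cost of [Q] must pay for the new block and for the tokens spent on [U']. For [t < #|U'|] at
   most [#|U'|.-1] tokens need paying: a marked [U'] is not tight by maximality of [t], and any
   other [U'] has an unmarked vertex. *)
case: (leqP #|U'| t) => U't.
  have := part_cost_ge_small #|Q| (leq_trans U't UMQ).
  have -> : minn #|U'|.-1 t = #|U'|.-1 by lia.
  by lia.
have -> : minn #|U'|.-1 t = t by lia.
have := part_cost_ge_large UMQ MQQ U't.
case: (boolP (U' \subset M)) => [U'M|nU'M].
  by have := maxt _ _ PR U'P U'M U't; rewrite (demand_rem _ _ QR); lia.
have : #|U' :&: M| < #|U'|.
  rewrite proper_card // properE subsetIl /=.
  by apply: contra nU'M => /subset_trans; apply; apply: subsetIr.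
by lia.
Qed.

(** Without tight marked sets, a move is safe for [U] as soon as it lowers the demand by
    [minn #|U|.-1 #|U :&: M|]; moves 3 and 4 rely on this. *)
Lemma marked_slack T A f s R M P U :
  good T A f s R ->
  (forall P U, P \in R -> U \subset P -> U \subset M -> 0 < #|U| ->
     demand #|U| s R < \sum_(v in U) f v) ->
  P \in R -> U \subset P ->
  demand #|U| s R + #|U :&: M| <= \sum_(v in U) f v + minn #|U|.-1 #|U :&: M|.
Proof.
move=> g loose PR UP; have := good_sum g PR UP.
have cU : #|U :&: M| <= #|U| by rewrite subset_leq_card ?subsetIl.
have [U0|U0] := posnP #|U|; first by lia.
case: (boolP (U \subset M)) => [UM|nUM]; first by have := loose _ _ PR UP UM U0; lia.
have : #|U :&: M| < #|U|.
  rewrite proper_card // properE subsetIl /=.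
  by apply: contra nUM => /subset_trans; apply; apply: subsetIr.
by lia.
Qed.

(** Each colored vertex of [B] lowers the demand by [minn #|U|.-1 l], enough for [marked_slack]
    because no part has more than [l] marked vertices. Blocks behind [B] have fewer vertices in
    front. *)
Lemma good_head T A f s1 l B s2 R M :
  good T A f (s1 ++ (l, B) :: s2) R ->
  (forall P U, P \in R -> U \subset P -> U \subset M -> 0 < #|U| ->
     demand #|U| (s1 ++ (l, B) :: s2) R < \sum_(v in U) f v) ->
  (forall P, P \in R -> #|P :&: M| <= l) ->
  (forall x, x \in s1 -> x.2 :&: M = set0) -> B :&: M != set0 ->
  good T (A :\: (M :&: B)) (spend f M) (s1 ++ (l, B :\: M) :: s2) R.
Proof.
move=> g loose leR s1M BM; split.
- move=> v /setDP[vA vMB]; have := good_cover g vA; rewrite !has_cat /= inE.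
  case: (has _ _) => //=; case: (has _ _) => /=; rewrite ?orbT ?orbF //=.
  case/orP => [vB|->]; last by rewrite orbT.
  by move: vMB; rewrite inE vB andbT => ->.
- move=> x; rewrite mem_cat inE => xs.
  have [xs'|/eqP xE] : x \in s1 ++ (l, B) :: s2 \/ x == (l, B :\: M).
  + by case/or3P: xs => xs; [left|right|left]; rewrite // mem_cat ?inE xs ?orbT.
  + exact: (good_block g).
  have [|iB lT] := good_block g (x := (l, B)); first by rewrite mem_cat mem_head orbT.
  by rewrite xE; split=> //; apply: independentS iB; apply: subsetDl.
- have := good_sorted g; rewrite !pairwise_cat /=.
  by rewrite !allrel_consr.
- exact: (good_part g).
- have := good_queue g; rewrite !queue_ok_cat /= => /and3P[q1 /forall_inP qB q2].
  apply/and3P; split.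
  + apply: queue_ok_spend q1 => x xs1.
    by rewrite s1M // eqxx addn0.
  + apply/forall_inP => v /setDP[vB vM]; rewrite /spend (negPf vM) subn0.
    exact: qB.
  apply: queue_ok_spend q2 => x _.
  have : 0 < #|B :&: M| by rewrite card_gt0.
  by have := cardsID M B; case: (_ != _) => /=; lia.
move=> P U PR UP; apply: le_sum_spend.
have := marked_slack g loose PR UP; rewrite !demand_cat !demand_cons /=.
have : 0 < #|B :&: M| by rewrite card_gt0.
have : #|U :&: M| <= l.
  by apply: leq_trans (leR _ PR); apply: subset_leq_card; apply: setSI.
have := cardsID M B.
set a := minn _ l; set b := minn _ #|_ :&: M| => <- Ul B0.
suff : b <= a * #|B :&: M| by rewrite mulnDr; lia.
by rewrite -[b]muln1 leq_mul // /a /b; lia.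
Qed.

Lemma good_cover_part T A f s R M Q :
  good T A f s R -> Q \in R -> forall v, v \in A :\: (M :&: Q) ->
  [|| v \in Q :\: M, has (fun x : nat * {set G} => v \in x.2) s
    | has (fun P : {set G} => v \in P) (rem Q R)].
Proof.
move=> g QR v /setDP[vA vMQ]; have := good_cover g vA; rewrite inE.
case: (has _ s) => /=; rewrite ?orbT //= => vR.
move: vMQ; rewrite inE; case: (boolP (v \in Q)) => vQ; first by rewrite !andbT => ->.
by rewrite (has_rem vQ vR) orbT.
Qed.

(** [part_cost_drop] lowers the demand as [marked_slack] requires, since [Q] has the most marked
    vertices. Any marked block has a level below [#|M :&: Q|] and is compensated by
    [part_delay_drop]. *)
Lemma good_regular T A f s R M Q :
  good T A f s R -> Q \in R -> 1 < #|Q :\: M| -> 0 < #|M :&: Q| ->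
  (forall P U, P \in R -> U \subset P -> U \subset M -> 0 < #|U| ->
     demand #|U| s R < \sum_(v in U) f v) ->
  (forall P, P \in R -> #|M :&: P| <= #|M :&: Q|) ->
  (forall x, x \in s -> #|M :&: Q| <= x.1 -> x.2 :&: M = set0) ->
  good T (A :\: (M :&: Q)) (spend f M) s ((Q :\: M) :: rem Q R).
Proof.
move=> g QR QM2 MQ0 loose leR sM.
have cQM : #|Q :\: M| = #|Q| - #|M :&: Q| by apply: cardsDI.
have [iQ Q2 QT] := good_part g QR; split.
- move=> v vA; have := good_cover_part g QR vA.
  by rewrite /= orbCA.
- exact: (good_block g).
- exact: (good_sorted g).
- move=> P; rewrite inE => /predU1P[->|/mem_rem]; last exact: (good_part g).
  by split; [apply: independentS iQ; apply: subsetDl|done|lia].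
- apply: queue_ok_spend (good_queue g) => x xs.
  have wQ : #|M :&: Q|.+2 <= #|Q| by lia.
  rewrite (delay_rem _ QR) delay_cons cQM !add0n addnAC leq_add2r.
  apply: leq_trans (part_delay_drop x.1 wQ); rewrite leq_add2l.
  by case: leqP => lx; [rewrite sM // eqxx | case: (_ != _)].
move=> P U; rewrite inE => PR UP; apply: le_sum_spend.
have eD : demand #|U| s (Q :\: M :: rem Q R) + minn #|U|.-1 #|M :&: Q| <= demand #|U| s R.
  have wQ : #|M :&: Q|.+2 <= #|Q| by lia.
  rewrite (demand_rem _ _ QR) /demand big_cons cQM.
  by have := part_cost_drop #|U| wQ; lia.
have [PE|PR'] := predU1P PR.
  have -> : U :&: M = set0.
    by apply/eqP; rewrite -subset0; apply/subsetP => v; rewrite !inE;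
       case/andP => /(subsetP UP); rewrite PE inE => /andP[/negPf ->].
  have UQ : U \subset Q by rewrite PE in UP; apply: subset_trans UP (subsetDl _ _).
  by have := good_sum g QR UQ; rewrite cards0; lia.
have {}PR := mem_rem PR'; have := marked_slack g loose PR UP.
have : #|U :&: M| <= #|M :&: Q|.
  by apply: leq_trans (leR _ PR); rewrite setIC subset_leq_card ?setIS.
by lia.
Qed.

(** The cost of [Q] pays for the tokens spent and for the new singleton block, whose factor is at
    most [#|U|.-1]; [part_delay_last] makes up for the extra vertex in front of the queue. *)
Lemma good_last T A f s R M Q :
  good T A f s R -> Q \in R -> #|Q :\: M| = 1 ->
  (forall P U, P \in R -> U \subset P -> U \subset M -> 0 < #|U| ->
     demand #|U| s R < \sum_(v in U) f v) ->
  (forall P, P \in R -> #|M :&: P| <= #|M :&: Q|) ->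
  (forall x, x \in s -> #|M :&: Q| <= x.1 -> x.2 :&: M = set0) ->
  good T (A :\: (M :&: Q)) (spend f M) ((T, Q :\: M) :: s) (rem Q R).
Proof.
move=> g QR QM1 loose leR sM.
have cQM : #|Q :\: M| = #|Q| - #|M :&: Q| by apply: cardsDI.
have [iQ Q2 QT] := good_part g QR; split.
- move=> v vA; have := good_cover_part g QR vA.
  by rewrite /= orbA.
- move=> x; rewrite inE => /predU1P[->|]; last exact: (good_block g).
  by split=> //; apply: independentS iQ; apply: subsetDl.
- rewrite /= (good_sorted g) andbT; apply/allP => x xs.
  by have [] := good_block g xs.
- by move=> P /mem_rem PR; apply: (good_part g).
- rewrite /=; apply/andP; split.
    apply/forall_inP => v /setDP[vQ vM]; rewrite /spend (negPf vM) subn0.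
    (* The demand on one vertex is the number of parts, while at level [T] every part other than [Q]
       delays only once. *)
    have vQ' : [set v] \subset Q by rewrite sub1set.
    have := good_sum g QR vQ'; rewrite cards1 big_set1 => /(leq_trans _); apply.
    rewrite demand1 delay_top => [|P /mem_rem PR]; last by have [] := good_part g PR.
    by rewrite size_rem //; case: R QR {g loose leR}.
  apply: queue_ok_spend (good_queue g) => x xs.
  have wQ : #|Q| = #|M :&: Q|.+1 by lia.
  rewrite (delay_rem _ QR) wQ QM1 !add0n addnAC leq_add2r.
  apply: leq_trans (part_delay_last x.1 _); rewrite leq_add2l.
  by case: leqP => lx; [rewrite sM // eqxx | case: (_ != _)].
move=> P U /mem_rem PR UP; apply: le_sum_spend.
have := marked_slack g loose PR UP.
have : #|U :&: M| <= #|M :&: Q|.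
  by apply: leq_trans (leR _ PR); rewrite setIC subset_leq_card ?setIS.
have [->|U0] := posnP #|U|.
  by rewrite !demand0 min0n addn0.
rewrite demand_cons (demand_rem _ _ QR) QM1 /=.
have := part_cost_ge_last #|M :&: Q| U0.
have -> : #|M :&: Q|.+1 = #|Q| by lia.
by lia.
Qed.

End Positions.

(** * The choice of Bob's move *)

Lemma has_first (E : eqType) (p : pred E) (s : seq E) : has p s ->
  exists s1 x s2, [/\ s = s1 ++ x :: s2, p x & forall y, y \in s1 -> ~~ p y].
Proof.
move=> ps; case: (split_find ps) => x s1 s2 px /hasPn ns1.
by exists s1, x, s2; rewrite cat_rcons.
Qed.

Lemma seq_argmax (E : eqType) (F : E -> nat) (s : seq E) :
  s = [::] \/ exists2 x, x \in s & forall y, y \in s -> F y <= F x.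
Proof.
elim: s => [|x s [->|[y ys ymax]]]; [by left|right|right].
  by exists x => [|y]; rewrite inE // => /eqP->.
case: (leqP (F x) (F y)) => xy; [exists y|exists x]; rewrite ?inE ?eqxx ?ys ?orbT //.
  by move=> z /predU1P[->|/ymax].
by move=> z /predU1P[->|/ymax zy] //; apply: leq_trans zy (ltnW xy).
Qed.

Lemma good_loose {G : sgraph} (T : nat) (A : {set G}) (f : G -> nat)
    (s : seq (nat * {set G})) (R : seq {set G}) (M : {set G}) :
  good T A f s R -> M \subset A -> M != set0 ->
  (forall P, P \in R -> ~~ (P \subset M)) ->
  (forall (P U : {set G}), P \in R -> U \subset P -> U \subset M -> 0 < #|U| ->
     demand #|U| s R < \sum_(v in U) f v) ->
  exists X : {set G}, [/\ X \subset M, independent X &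
    exists s' R', good T (A :\: X) (spend f M) s' R'].
Proof.
move=> g /subsetP MA /set0Pn[v vM] nofull loose.
(* Move 3: levels decrease along the queue, so the first marked block has level at least [w] if any
   marked block has. *)
have headP w : (forall P, P \in R -> #|P :&: M| <= w) ->
    has (fun x : nat * {set G} => (w <= x.1) && (x.2 :&: M != set0)) s ->
  exists X : {set G}, [/\ X \subset M, independent X &
    exists s' R', good T (A :\: X) (spend f M) s' R'].
  move=> leR /hasP[y ys /andP[wy yM]].
  have /has_first : has (fun x : nat * {set G} => x.2 :&: M != set0) s.
    by apply/hasP; exists y.
  case=> s1 [[l B] [s2 [sE BM s1M]]].
  have wl : w <= l.
    move: ys (good_sorted g); rewrite sE mem_cat inE pairwise_cat /=.
    case/or3P => [ys1|/eqP yE _|ys2]; first by rewrite (negPf (s1M _ ys1)) in yM.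
      by rewrite yE in wy.
    by case/and4P => _ _ /allP/(_ _ ys2) /= yl _; apply: leq_trans wy yl.
  exists (M :&: B); split; first exact: subsetIl.
    have [|iB _] := good_block g (x := (l, B)); first by rewrite sE mem_cat mem_head orbT.
    by apply: independentS iB; apply: subsetIr.
  exists (s1 ++ (l, B :\: M) :: s2), R; rewrite sE in g loose.
  apply: good_head g _ _ _ _ => //.
    by move=> P /leR Pw; apply: leq_trans wl.
  by move=> x /s1M /negPn /eqP.
have [RE|[Q QR Qmax]] := seq_argmax (fun Q => #|M :&: Q|) R.
  apply: (headP 0); first by rewrite RE.
  have := good_cover g (MA _ vM); rewrite RE orbF => /hasP[x xs vx].
  by apply/hasP; exists x => //; apply/set0Pn; exists v; rewrite inE vx.
have leR P : P \in R -> #|P :&: M| <= #|M :&: Q| by rewrite setIC; apply: Qmax.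
case: (boolP (has (fun x : nat * {set G} => (#|M :&: Q| <= x.1) && (x.2 :&: M != set0)) s)).
  exact: headP.
move=> /hasPn nos.
have sM x : x \in s -> #|M :&: Q| <= x.1 -> x.2 :&: M = set0.
  by move=> /nos; rewrite negb_and => /orP[/negP //|/negPn /eqP].
(* Otherwise no part is marked, and a marked vertex would lie in a block, whose level is at least
   0. *)
have MQ0 : 0 < #|M :&: Q|.
  rewrite lt0n; apply/eqP => MQ0; have /orP[/hasP[x xs vx]|/hasP[P PR vP]] := good_cover g (MA _ vM).
    have : v \in x.2 :&: M by rewrite inE vx.
    by rewrite sM ?inE ?MQ0.
  have : v \in M :&: P by rewrite inE vM.
  by have := Qmax P PR; rewrite MQ0 leqn0 cards_eq0 => /eqP ->; rewrite inE.
have [iQ Q2 _] := good_part g QR.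
exists (M :&: Q); split; first exact: subsetIl.
  by apply: independentS iQ; apply: subsetIr.
have QM0 : 0 < #|Q :\: M| by rewrite card_gt0 setD_eq0 nofull.
have [QM1|QM2] := leqP #|Q :\: M| 1.
  exists ((T, Q :\: M) :: s), (rem Q R).
  by apply: good_last => //; apply/eqP; rewrite eqn_leq QM1.
by exists s, (Q :\: M :: rem Q R); apply: good_regular.
Qed.

Lemma good_step {G : sgraph} (T : nat) (A : {set G}) (f : G -> nat)
    (s : seq (nat * {set G})) (R : seq {set G}) (M : {set G}) :
  good T A f s R -> M \subset A -> M != set0 ->
  exists X : {set G}, [/\ X \subset M, independent X &
    exists s' R', good T (A :\: X) (spend f M) s' R'].
Proof.
move=> g MA M0.
case: (boolP (has (fun Q : {set G} => Q \subset M) R)) => [/hasP[Q QR QM]|/hasPn nofull].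
  exists Q; split=> //; first by have [] := good_part g QR.
  by exists s, (rem Q R); apply: good_full.
pose tight n := has (fun Q : {set G} => [exists U : {set G},
  [&& U \subset Q, U \subset M, #|U| == n, 0 < n
    & \sum_(v in U) f v <= demand n s R]]) R.
have tightP Q (U : {set G}) : Q \in R -> U \subset Q -> U \subset M -> 0 < #|U| ->
    \sum_(v in U) f v <= demand #|U| s R -> tight #|U|.
  move=> QR UQ UM U0 tU; apply/hasP; exists Q => //; apply/existsP; exists U.
  by rewrite UQ UM eqxx U0.
(* Move 2 needs a tight set of maximal cardinality over all parts together. *)
case: (pselect (exists n, tight n)) => [ex_tight|no_tight]; last first.
  apply: (good_loose g) => // P U PR UP UM U0; rewrite ltnNge; apply/negP => tU.
  by apply: no_tight; exists #|U|; apply: (tightP P).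
have le_tight n : tight n -> n <= #|G|.
  by case/hasP => Q _ /existsP[U /and5P[_ _ /eqP <- _ _]]; apply: max_card.
case: (ex_maxnP ex_tight le_tight) => n /hasP[Q QR].
case/existsP => U /and5P[UQ UM /eqP <- U0 tU] maxU.
exists (M :&: Q); have [iQ _ _] := good_part g QR; split.
- exact: subsetIl.
- by apply: independentS iQ; apply: subsetIr.
do 2 eexists; apply: good_tight g QR _ UQ UM U0 tU _ => // P U' PR UP UM' UU'.
rewrite ltnNge; apply/negP => tU'.
have := maxU _ (tightP _ _ PR UP UM' (leq_ltn_trans (leq0n _) UU') tU').
by rewrite leqNgt => /negP.
Qed.

(** * From the invariant to a strategy of Bob *)

Lemma queue_ok_gt0 {G : sgraph} (f : G -> nat) (R : seq {set G}) a
    (s : seq (nat * {set G})) x v :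
  queue_ok f R a s -> x \in s -> v \in x.2 -> 0 < f v.
Proof.
elim: s a => //= y s IH a /andP[/forall_inP yf sf]; rewrite inE.
by case/predU1P => [-> /yf|]; [apply: leq_trans|apply: IH sf].
Qed.

Lemma good_gt0 {G : sgraph} (T : nat) (A : {set G}) (f : G -> nat)
    (s : seq (nat * {set G})) (R : seq {set G}) v :
  good T A f s R -> v \in A -> 0 < f v.
Proof.
move=> g /(good_cover g) /orP[/hasP[x xs vx]|/hasP[Q QR vQ]].
  exact: queue_ok_gt0 (good_queue g) xs vx.
have vQ' : [set v] \subset Q by rewrite sub1set.
have := good_sum g QR vQ'; rewrite cards1 demand1 big_set1; apply: leq_trans.
by case: R QR {g}.
Qed.

Lemma online_choosable_invariant {G : sgraph} (I : {set G} -> (G -> nat) -> Prop) k :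
  (forall (A : {set G}) f v, I A f -> v \in A -> 0 < f v) ->
  (forall A f (M : {set G}), I A f -> M \subset A -> M != set0 ->
     exists X : {set G}, [/\ X \subset M, independent X & I (A :\: X) (spend f M)]) ->
  I setT (fun=> k) -> online_choosable G k.
Proof.
move=> I_gt0 I_step I0.
have /choice[bob bobP] : forall p : {set G} * (G -> nat) * {set G}, exists X : {set G},
    I p.1.1 p.1.2 -> p.2 \subset p.1.1 -> p.2 != set0 ->
    [/\ X \subset p.2, independent X & I (p.1.1 :\: X) (spend p.1.2 p.2)].
  move=> [[A f] M] /=; case: (pselect [/\ I A f, M \subset A & M != set0]).
    by case=> If MA M0; have [X XP] := I_step _ _ _ If MA M0; exists X.
  by move=> H; exists set0 => *; case: H.
(* A strategy sees only the marked sets, so the position is recomputed from the history. *)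
pose pos := fix pos (h : seq {set G}) : {set G} * (G -> nat) :=
  if h is M :: h' then ((pos h').1 :\: bob (pos h', M), spend (pos h').2 M)
  else (setT, fun=> k).
pose s : strategy G := fun h => if h is M :: h' then bob (pos h', M) else set0.
have unc h : uncolored s h = (pos h).1 by elim: h => //= M h ->.
have legal_I h : legal s h -> I (pos h).1 (pos h).2.
  elim: h => //= M h IH /and3P[/IH Ih M0]; rewrite unc => MA.
  by have [_ _] := bobP (pos h, M) Ih MA M0.
(* Truncated subtraction loses nothing: by [I_gt0] an uncolored vertex has a token before each
   mark. *)
have marksE h v : legal s h -> v \in (pos h).1 -> marks h v + (pos h).2 v = k.
  elim: h => //= M h IH /and3P[lh M0 MA] /setDP[vA _].
  have := I_gt0 _ _ _ (legal_I _ lh) vA; have := IH lh vA.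
  by rewrite /marks /= /spend; case: (v \in M); lia.
exists s; split.
  move=> M h /= /and3P[lh M0]; rewrite unc => MA.
  by have [? ? _] := bobP (pos h, M) (legal_I _ lh) MA M0.
move=> h v lh; rewrite unc => vA; rewrite ltz_nat.
by have := I_gt0 _ _ _ (legal_I _ lh) vA; have := marksE _ _ lh vA; lia.
Qed.

Lemma good_online_choosable {G : sgraph} (T k : nat)
    (s : seq (nat * {set G})) (R : seq {set G}) :
  good T setT (fun=> k) s R -> online_choosable G k.
Proof.
move=> g; pose I (A : {set G}) (f : G -> nat) := exists s' R', @good G T A f s' R'.
apply: (online_choosable_invariant (I := I)); last by exists s, R.
  by move=> A f v [s' [R' g']]; apply: good_gt0 g'.
by move=> A f M [s' [R' g']]; apply: good_step g'.
Qed.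

(** * The initial position given by a coloring *)

Lemma queue_ok_const {G : sgraph} (T k : nat) (R : seq {set G}) a
    (s : seq (nat * {set G})) :
  (forall x, x \in s -> x.1 = T /\ #|x.2| = 1) ->
  a + size s + delay T R <= k -> queue_ok (fun=> k) R a s.
Proof.
elim: s a => //= x s IH a sT ask; have [-> x1] := sT x (mem_head _ _).
apply/andP; split; first by apply/forall_inP => v _; lia.
by apply: IH => [y ys|]; [apply: sT; rewrite inE ys orbT | rewrite x1; lia].
Qed.

Definition class {G : sgraph} {k} (c : G -> 'I_k) (i : 'I_k) : {set G} :=
  [set v | c v == i].

Lemma independent_class {G : sgraph} k (c : G -> 'I_k) i :
  (forall x y, adj x y -> c x != c y) -> independent (class c i).
Proof.
move=> c_proper; apply/forall_inP => x; rewrite inE => /eqP cx.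
apply/forall_inP => y; rewrite inE => /eqP cy.
by apply/negP => /c_proper; rewrite cx cy eqxx.
Qed.

(** Singletons start at the top level [T], where each part delays by 1 only, so [k] tokens suffice
    for the queue. *)
Lemma coloring_online_choosable {G : sgraph} (T k : nat) (c : G -> 'I_k) :
  (forall x y, adj x y -> c x != c y) ->
  (forall i, 0 < #|class c i| <= T.+1) ->
  \sum_(i | 1 < #|class c i|) ('C(#|class c i|.-1, 2)).+1 <= k ->
  online_choosable G k.
Proof.
move=> c_proper c_size c_sum; have iP i := independent_class i c_proper.
pose s := [seq (T, class c i) | i <- enum 'I_k & #|class c i| == 1].
pose R := [seq class c i | i <- enum 'I_k & 1 < #|class c i|].
have RP Q : Q \in R -> exists2 i, Q = class c i & 1 < #|class c i|.
  by case/mapP => i; rewrite mem_filter => /andP[i1 _] ->; exists i.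
have sP x : x \in s -> exists2 i, x = (T, class c i) & #|class c i| = 1.
  by case/mapP => i; rewrite mem_filter => /andP[/eqP i1 _] ->; exists i.
have RT Q : Q \in R -> #|Q| <= T.+1.
  by case/RP => i -> _; have /andP[] := c_size i.
have size_sR : size s + size R = k.
  rewrite !size_map !size_filter -[RHS]card_ord cardE -(count_predC (fun i => #|class c i| == 1)).
  congr (_ + _); apply: eq_count => i /=.
  by have := c_size i; case: (#|_|) => [|[]].
have sum_R : \sum_(Q <- R) ('C(#|Q|.-1, 2)).+1 <= k.
  by rewrite big_map big_filter big_enum_cond.
apply: (@good_online_choosable G T k s R); split.
- move=> v _; have := c_size (c v); case/andP => c0 _.
  have [c1|c2] := leqP #|class c (c v)| 1; apply/orP; [left|right]; apply/hasP.
    exists (T, class c (c v)); last by rewrite inE.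
    by apply: map_f; rewrite mem_filter mem_enum andbT eqn_leq c1.
  exists (class c (c v)); last by rewrite inE.
  by apply: map_f; rewrite mem_filter mem_enum andbT.
- by move=> x /sP[i -> _]; split; [apply: iP | apply: leqnn].
- rewrite pairwise_map; elim: (filter _ _) => //= i l ->; rewrite andbT.
  by apply/allP => j _; apply: leqnn.
- by move=> Q QR; have [i QE i1] := RP _ QR; split; [rewrite QE; apply: iP | rewrite QE | apply: RT].
- apply: (@queue_ok_const _ T) => [x /sP[i -> i1] //|].
  by rewrite delay_top // add0n size_sR.
move=> Q U QR UQ; rewrite sum_nat_const.
have [->|U0] := posnP #|U|; first by rewrite demand0.
(* Of the [#|U| * k] tokens each singleton class uses at most [#|U|.-1] out of its [#|U|]; the spare
   ones cover the binomials of the parts. *)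
have ds : \sum_(x <- s) minn #|U|.-1 x.1 * #|x.2| <= #|U|.-1 * size s.
  rewrite -sum1_size big_distrr /= big_seq [X in _ <= X]big_seq; apply: leq_sum => x /sP[i -> ->].
  by rewrite leq_mul // geq_minl.
have dR : \sum_(P <- R) part_cost #|U| #|P| + size R <=
    #|U| * size R + \sum_(P <- R) ('C(#|P|.-1, 2)).+1.
  rewrite -sum1_size big_distrr -!big_split /=; apply: leq_sum => P _.
  by have := part_cost_le #|U| #|P|; lia.
by rewrite /demand; nia.
Qed.

(** * Chromatic number and on-line choosability *)

Lemma chromatic_coloring (G : sgraph) :
  exists c : G -> 'I_(chromatic_number G),
    (forall x y, adj x y -> c x != c y) /\ (forall i, 0 < #|class c i|).
Proof.
rewrite /chromatic_number; case: ex_minnP => k /existsP[c /forallP c_proper] min_k.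
have cP x y : adj x y -> c x != c y by have /forallP/(_ y)/implyP := c_proper x.
exists c; split=> // i; rewrite card_gt0; apply/set0Pn; apply: contrapT => no_i.
have ci v : i != c v.
  by apply/eqP => iv; apply: no_i; exists v; rewrite inE iv.
(* With class [i] empty, [unlift i] renumbers the colors into one fewer, against minimality. *)
case: k i c cP min_k {c_proper no_i} ci => [[] //|k] i c cP min_k ci.
suff /min_k : colorable G k by rewrite ltnn.
apply/existsP.
have un v : exists j, unlift i (c v) == Some j.
  by case: (unlift_some (ci v)) => j _ ->; exists j.
have lift_un v : lift i (xchoose (un v)) = c v.
  have /eqP := xchooseP (un v); move: (xchoose _) => j.
  by case: (unlift_some (ci v)) => a -> -> [->].
exists [ffun v => xchoose (un v)]; apply/forallP => x; apply/forallP => y.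
apply/implyP => /cP; rewrite !ffunE; apply: contra => /eqP exy.
by rewrite -(lift_un x) -(lift_un y) exy.
Qed.

(** Alice marks all uncolored vertices in every round; the number of the round in which Bob colors a
    vertex is its color. *)
Lemma online_choosable_colorable (G : sgraph) (k : nat) :
  online_choosable G k -> colorable G k.
Proof.
case=> s [s_move s_win].
have play i : exists h, [/\ legal s h, (forall v, v \in uncolored s h -> marks h v = i) &
    exists c : G -> nat, (forall v, v \notin uncolored s h -> c v < i) /\
      (forall x y, x \notin uncolored s h -> y \notin uncolored s h -> adj x y -> c x != c y)].
  elim: i => [|i [h [lh mh [c [ci c_proper]]]]].
    by exists [::]; split=> //; exists (fun=> 0); split=> [v|x y]; rewrite inE.
  have [U0|U0] := eqVneq (uncolored s h) set0.
    exists h; split=> //; first by move=> v; rewrite U0 inE.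
    by exists c; split=> // v /ci /ltnW.
  pose M := uncolored s h; have lM : legal s (M :: h) by rewrite /= lh U0 subxx.
  have [/subsetP sM /forall_inP iM] := s_move _ _ lM.
  exists (M :: h); split=> //.
    by move=> v /setDP[vM _]; rewrite /marks /= vM -(mh v vM).
  exists (fun v => if v \in M then i else c v); split=> [v|x y] /=.
    by rewrite inE -/M; case: (boolP (v \in M)) => [|/ci] // /ltnW.
  rewrite !inE -/M; case: (boolP (x \in M)) => xM; case: (boolP (y \in M)) => yM;
    rewrite /= ?andbT ?andbF ?negbK => xs ys xy.
  - by have /forall_inP/(_ _ ys) := iM _ xs; rewrite xy.
  - by rewrite gtn_eqF // ci.
  - by rewrite ltn_eqF // ci.
  - exact: c_proper.
have [h [lh mh [c [ck c_proper]]]] := play k.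
have col v : v \notin uncolored s h.
  by apply/negP => vU; have := s_win _ _ lh vU; rewrite (mh v vU) ltz_nat ltnn.
apply/existsP; exists [ffun v => Ordinal (ck v (col v))].
apply/forallP => x; apply/forallP => y; apply/implyP => xy.
by rewrite !ffunE -val_eqE /= c_proper.
Qed.

(** * Class sizes and the bound on the order of the graph *)

(** The quotient (binomial(q, 2) + 1)/q = (q - 1)/2 + 1/q is nondecreasing on positive integers;
    equality holds at [q = T]. *)
Lemma class_weight_le (T q : nat) :
  0 < q -> q <= T -> 2 * T * ('C(q, 2)).+1 <= (T * T.-1 + 2) * q.
Proof.
move=> q0 qT; have := bin_ffact q 2; rewrite ffactnS ffactn1 => C2.
have -> : 2 * T * ('C(q, 2)).+1 = T * (q * q.-1 + 2) by rewrite -C2 (_ : 2`! = 2) //; nia.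
case: q q0 qT {C2} => // r _ rT; have := subnK rT; move: (T - r.+1) => d <- /=.
by rewrite addnS /=; case: d => [|d]; nia.
Qed.

(** Taking one element off each class turns the last hypothesis into a bound [2 * T * #|I|] on the
    weighted sum of the [(p i).-1], to which [class_weight_le] applies termwise. *)
Lemma class_weight_sum (I : finType) (T : nat) (p : I -> nat) :
  0 < T -> (forall i, 0 < p i <= T.+1) ->
  (T * T.-1 + 2) * \sum_i p i <= (T * T.+1 + 2) * #|I| ->
  \sum_(i | 1 < p i) ('C((p i).-1, 2)).+1 <= #|I|.
Proof.
move=> T0 pT le_pI; set W := \sum_(i | _) _.
have sum_p : \sum_i p i = \sum_i (p i).-1 + #|I|.
  rewrite -sum1_card -big_split; apply: eq_bigr => i _ /=.
  by have := pT i; lia.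
have leW : 2 * T * W <= (T * T.-1 + 2) * \sum_i (p i).-1.
  rewrite /W !big_distrr [X in X <= _]big_mkcond /=; apply: leq_sum => i _.
  case: (ltnP 1 (p i)) => [i1|_] //.
  have /andP[_ iT] := pT i.
  by apply: class_weight_le; lia.
have eT : T * T.+1 + 2 = T * T.-1 + 2 + 2 * T by case: (T) T0 => // t _ /=; lia.
rewrite eT sum_p mulnDr [X in _ <= X]mulnDl [X in _ <= X]addnC leq_add2r in le_pI.
have := leq_trans leW le_pI.
by rewrite leq_pmul2l // muln_gt0.
Qed.

Import Order.TTheory GRing.Theory Num.Theory.
Local Open Scope ring_scope.
Unset Implicit Arguments.

Theorem corollary10 (G : sgraph) (m : nat)
    (Gm : independence_number G = m) (m_ge2 : (2 <= m)%N)
    (leG : (#|G|%:R : rat) <=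
       (m%:R ^+ 2 - m%:R + 2) / (m%:R ^+ 2 - 3 * m%:R + 4)
       * (chromatic_number G)%:R) :
  chromatic_number G = online_choice_number G.
Proof.
have [c [c_proper c0]] := chromatic_coloring G.
apply/eqP; rewrite eqn_leq; apply/andP; split.
  rewrite /online_choice_number; case: ex_minnP => k /asboolP ok _.
  rewrite /chromatic_number; case: ex_minnP => j _; apply.
  exact: online_choosable_colorable.
rewrite /online_choice_number; case: ex_minnP => k _; apply; apply/asboolP.
case: m Gm m_ge2 leG => // T Gm T0 leG.
have cT i : (0 < #|class c i| <= T.+1)%N.
  rewrite c0 -Gm /independence_number.
  by apply: (leq_bigmax_cond (F := fun A : {set G} => #|A|)); apply: independent_class.
apply: (@coloring_online_choosable G T _ c) => //.
rewrite -[X in (_ <= X)%N]card_ord; apply: (class_weight_sum T0) => //.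
have -> : (\sum_i #|class c i| = #|G|)%N.
  rewrite -sum1_card (partition_big c xpredT) //=; apply: eq_bigr => i _.
  by rewrite -sum1_card; apply: eq_bigl => v; rewrite inE.
rewrite card_ord -(ler_nat rat) !natrM !natrD !natrM.
(* With t = m - 2 the denominator m^2 - 3m + 4 reads [(t + 1) * t + 2], free of predecessors and
   visibly positive. *)
have eT : T%:R = T.-1%:R + 1 :> rat by rewrite -[1]/(1%:R) -natrD addn1 prednK.
have T_ge0 : 0 <= T.-1%:R :> rat by rewrite ler0n.
move: leG; rewrite -[T.+1]addn1 natrD eT; move: T.-1%:R T_ge0 => t t0 leG.
have d0 : 0 < (t + 1) * t + 2 by nra.
rewrite mulrC -ler_pdivlMr //; apply: (le_trans leG); rewrite le_eqVlt; apply/orP; left; apply/eqP.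
by field; rewrite gt_eqF.
Qed.
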